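(* No interval exchange transformation is topologically mixing of all orders. That is, for every $d\ge 1$ and every $d$-interval exchange transformation $T\colon[0,1)\to[0,1)$, $T$ is not topologically mixing of all orders.
   Context: Let $\Delta_{d-1}=\{(l_1,\dots,l_d): l_i>0,\ l_1+\dots+l_d=1\}$. Given $(l_1,\dots,l_d)\in\Delta_{d-1}$, let $I_1=[0,l_1)$, $I_2=[l_1,l_1+l_2)$, ..., $I_d=[l_1+\dots+l_{d-1},1)$. Given also a permutation $\pi$ of $\{1,\dots,d\}$, the associated $d$-interval exchange transformation is the map $T\colon[0,1)\to[0,1)$ defined by $T(x)=x-\sum_{k<j}l_k+\sum_{\pi(k')<\pi(j)}l_{k'}$ for $x\in I_j$. The interval $[0,1)$ carries its standard topology. A map $T\colon X\to X$ of a topological space is topologically mixing of all orders if for every integer $p\ge1$ and all nonempty open sets $U_0,U_1,\dots,U_p\subseteq X$ there exists $N$ such that $U_0\cap T^{-n_1}(U_1)\cap T^{-n_2}(U_2)\cap\dots\cap T^{-n_p}(U_p)\ne\emptyset$ for all integers $n_1,\dots,n_p$ satisfying $n_1\ge N$ and $n_{i+1}-n_i\ge N$ for $1\le i<p$. *)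

(* Defs.v *)
From mathcomp Require Import all_boot all_order all_fingroup all_algebra.
From mathcomp Require Import all_classical all_reals topology normedtype.

Set Implicit Arguments.
Unset Strict Implicit.
Unset Printing Implicit Defensive.

Import Order.TTheory GRing.Theory Num.Theory.
Import numFieldNormedType.Exports.

Local Open Scope classical_set_scope.
Local Open Scope ring_scope.

(* U and n are indexed by all of nat, but only U 0, ..., U p and n 1, ..., n p
   are constrained or used.  The condition n_(i+1) - n_i >= N is stated
   additively because subtraction on nat is truncated. *)
Definition mixing_all_orders (X : topologicalType) (T : X -> X) : Prop :=
  forall (p : nat) (U : nat -> set X),
    (1 <= p)%N ->
    (forall i, (i <= p)%N -> open (U i) /\ U i !=set0) ->
    exists N : nat, forall n : nat -> nat,
      (N <= n 1%N)%N ->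
      (forall i, (1 <= i < p)%N -> (n i + N <= n i.+1)%N) ->
      (U 0%N `&` \bigcap_(i in [set i | (1 <= i <= p)%N])
                 (iter (n i) T @^-1` U i)) !=set0.

(* As a type, this carries the subspace topology inherited from R
   (the canonical topology on set_type). *)
Definition unit_ico (R : realType) : set R := `[0, 1[.
Arguments unit_ico : clear implicits.

Section IntervalExchange.
Variables (R : realType) (d : nat).
Implicit Types (l : 'I_d -> R) (pi : 'S_d) (j k : 'I_d).

Definition simplex : set ('I_d -> R) :=
  [set l | (forall j, 0 < l j) /\ \sum_j l j = 1].

(* The intervals are numbered from 0; for l in the simplex the right endpoint
   of the last one is \sum_k l k = 1. *)
Definition iet_interval l j : set R :=
  `[\sum_(k < d | (k < j)%N) l k, \sum_(k < d | (k <= j)%N) l k[.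

Definition is_iet l pi (T : unit_ico R -> unit_ico R) : Prop :=
  forall (x : unit_ico R) j, iet_interval l j (val x) ->
    val (T x) = val x - \sum_(k < d | (k < j)%N) l k
                      + \sum_(k < d | (pi k < pi j)%N) l k.

Lemma simplex_cover l (x : R) : simplex l -> unit_ico R x ->
  exists j, iet_interval l j x.
Proof.
move=> [l0 l1]; rewrite /unit_ico /= in_itv /= => /andP[x0 x1].
have d0 : (0 < d)%N.
  case: (posnP d) => // dE; exfalso; move: l1; rewrite big1 => [/eqP|i _].
    by rewrite eq_sym oner_eq0.
  by have := ltn_ord i; rewrite {2}dE.
pose P m := (m <= d)%N && (x < \sum_(k < d | (k < m)%N) l k).
have exP : exists m, P m.
  exists d; rewrite /P leqnn /=.
  by rewrite (eq_bigl predT) ?l1 // => k; rewrite ltn_ord.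
case: (ex_minnP exP) => [[|m]] /andP[md xm] mmin.
  by move: xm; rewrite big_pred0 // ltNge x0.
exists (Ordinal md); rewrite /iet_interval /= in_itv /= xm andbT.
rewrite leNgt; apply/negP => xm'.
by have := mmin m; rewrite /P xm' (ltnW md) ltnn => /(_ isT).
Qed.

Lemma iet_interval_inj l (x : R) i j : simplex l ->
  iet_interval l i x -> iet_interval l j x -> i = j.
Proof.
move=> [l0 _].
have le_sum (i' j' : 'I_d) : (i' < j')%N ->
    \sum_(k < d | (k <= i')%N) l k <= \sum_(k < d | (k < j')%N) l k.
  move=> ij; rewrite [leLHS]big_mkcond [leRHS]big_mkcond; apply: ler_sum => k _.
  case: (leqP k i') => [ki|_]; first by rewrite (leq_ltn_trans ki ij).
  by case: ifP => // _; exact: ltW.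
rewrite /iet_interval /= !in_itv /= => /andP[ax xb] /andP[a'x xb'].
apply/val_inj/eqP; rewrite eqn_leq; apply/andP; split; rewrite leqNgt;
  apply/negP => /le_sum h.
- by have := lt_le_trans xb' (le_trans h ax); rewrite ltxx.
- by have := lt_le_trans xb (le_trans h a'x); rewrite ltxx.
Qed.

Lemma is_iet_exists l pi : simplex l -> exists! T, is_iet l pi T.
Proof.
move=> sl; have [l0 l1] := sl.
have H (x : unit_ico R) : {y : unit_ico R | forall j,
    iet_interval l j (val x) ->
    val y = val x - \sum_(k < d | (k < j)%N) l k
                  + \sum_(k < d | (pi k < pi j)%N) l k}.
  have /cid[j jx] := simplex_cover sl (set_mem (valP x)).
  pose y := val x - \sum_(k < d | (k < j)%N) l k
                  + \sum_(k < d | (pi k < pi j)%N) l k.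
  have yI : y \in unit_ico R.
    move: (jx); rewrite /iet_interval /= in_itv /= => /andP[ax xb].
    rewrite inE /unit_ico /= in_itv /=; apply/andP; split.
      by apply: addr_ge0; [rewrite subr_ge0|apply: sumr_ge0 => k _; exact: ltW].
    move: xb; rewrite (bigD1 j) //= addrC => xb.
    have -> : 1 = l j + \sum_(k < d | k != j) l k by rewrite -l1 (bigD1 j).
    apply: ltr_leD.
      rewrite ltrBlDr; apply: (lt_le_trans xb); rewrite addrC lerD2l.
      by rewrite le_eqVlt; apply/orP; left; apply/eqP/eq_bigl => k;
        rewrite ltn_neqAle andbC.
    rewrite [leLHS]big_mkcond [leRHS]big_mkcond; apply: ler_sum => k _.
    case: (eqVneq k j) => [->|_]; first by rewrite ltnn.
    by case: ifP => // _; exact: ltW.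
  exists (exist _ y yI) => i ix.
  by rewrite (iet_interval_inj sl ix jx).
exists (fun x => sval (H x)); split => [x j|T' T'P].
  exact: (svalP (H x)).
apply/funext => x; apply: val_inj.
have [j jx] := simplex_cover sl (set_mem (valP x)).
by rewrite (T'P _ _ jx) (svalP (H x) _ jx).
Qed.

End IntervalExchange.

Arguments simplex : clear implicits.

(* Main.v *)
Require Import Defs.
From mathcomp Require Import all_boot all_order all_fingroup all_algebra.
From mathcomp Require Import all_classical all_reals topology normedtype.
From mathcomp Require Import lra.
Import numFieldNormedType.Exports.

(** An interval exchange always has simultaneous recurrence: there is a number
    [s], depending only on the number of intervals, such that arbitrarily late
    there are [s] times [r] with the property that every point [x] is moved by
    less than 1/2 by one of them.  This is Katok's argument against measure
    mixing.  Cut [0, 1) into Rokhlin towers over a small interval [J]: the base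
    [J] splits into few cells on which the first return time is constant, and
    all iterates up to that time act on a cell as one translation
    ([return_towers]).  The number of cells is bounded because a cell can only
    end at a point of [J] whose orbit meets a discontinuity or an endpoint of
    [J] before returning, and each such target is met by a single point of [J].
    Apply this again with each cell as base: if [x] is at level [k] of the tower
    over a cell [C], then at a return time [r] from the corresponding subcell of
    [C] to [C] the point is back in level [k] of the same tower, which is a
    short interval.  Hence [s = (m + 3) ^ 2] times suffice, with [m] the number
    of break points ([recurrence_times]).

    To contradict mixing, one constrains [x] to lie in (0, 1/4) and its
    images at times [r] to lie in (3/4, 1), for all the [s] times [r] at once.
    Mixing of order [s] does not apply directly, since the [r]'s may be close to
    one another.  So the times are spread: let [N] be the gap that mixing of
    order [2 s] provides for [s] copies of (0, 1/4) followed by [s] copies of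
    (3/4, 1).  For the sorted times [r_1 <= ... <= r_s], use the instants
    [N, 2 N, ..., s N] and [r_1 + N, ..., r_s + s N], whose gaps are all at least
    [N] if [r_1 >= s N].  This yields [x] with [T^(i N) x < 1/4] and
    [T^(i N + r_i) x > 3/4] for each [i], so what is needed is that [x] and
    [T^r x] stay within 1/2 of each other for a bounded number [M = s N] of
    further steps ([simultaneous_recurrence]).  This holds if [J] is chosen after
    [N], as a right neighbourhood of 0 on which the first [M] iterates are
    translations that move [J] off itself ([small_base]): the two points climb
    the tower together, and if they leave through its top they land together in
    [J], where [M] more iterates keep their distance.

    Mixing of order 1 supplies the rest: orbits reach [J] from every interval,
    and 0 is not periodic. *)

(** * Piecewise translations of the unit interval *)

Section PiecewiseTranslations.

Set Implicit Arguments.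
Unset Strict Implicit.
Unset Printing Implicit Defensive.
Import Order.TTheory GRing.Theory Num.Theory.
Local Open Scope ring_scope.

Variable R : realFieldType.
Implicit Types (a b c x y z w p q : R) (s : seq R).

Lemma floor_in_seq s a y : a <= y ->
  exists p, [/\ p \in a :: s, p <= y &
                forall q, q \in a :: s -> q <= y -> q <= p].
Proof.
move=> ay; elim: s => [|q s [p [ps py pmax]]].
  exists a; rewrite mem_head; split=> // q; rewrite inE => /eqP -> //.
pose r := if q <= y then Num.max p q else p.
exists r; split.
- rewrite /r !inE; move: ps; rewrite inE => /orP[/eqP->|ps].
    by case: ifP => _; [case: (leP a q) => _|]; rewrite eqxx ?orbT.
  by case: ifP => _; [case: (leP p q) => _|]; rewrite ?eqxx ?ps ?orbT.
- by rewrite /r; case: ifP => // qy; rewrite ge_max py.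
move=> u; rewrite !inE => /or3P[/eqP->|/eqP->|us] uy.
- have ap : a <= p by apply: pmax; rewrite ?mem_head.
  by rewrite /r; case: ifP => // _; rewrite le_max ap.
- by rewrite /r uy le_max lexx orbT.
- have up : u <= p by apply: pmax; rewrite // inE us orbT.
  by rewrite /r; case: ifP => // _; rewrite le_max up.
Qed.

Lemma next_in_seq s b y : y < b ->
  exists e, [/\ e \in b :: s, y < e &
                forall q, q \in b :: s -> y < q -> e <= q].
Proof.
move=> yb; elim: s => [|q s [p [ps py pmin]]].
  exists b; rewrite mem_head; split=> // q; rewrite inE => /eqP -> //.
pose r := if y < q then Num.min p q else p.
exists r; split.
- rewrite /r !inE; move: ps; rewrite inE => /orP[/eqP->|ps].
    by case: ifP => _; [case: (leP b q) => _|]; rewrite eqxx ?orbT.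
  by case: ifP => _; [case: (leP p q) => _|]; rewrite ?eqxx ?ps ?orbT.
- by rewrite /r; case: ifP => // qy; rewrite lt_min py.
move=> u; rewrite !inE => /or3P[/eqP->|/eqP->|us] uy.
- have pb : p <= b by apply: pmin; rewrite ?mem_head.
  by rewrite /r; case: ifP => // _; rewrite ge_min pb.
- by rewrite /r uy ge_min lexx orbT.
- have pu : p <= u by apply: pmin; rewrite // inE us orbT.
  by rewrite /r; case: ifP => // _; rewrite ge_min pu.
Qed.

(** [D] lists the points where [f] may jump.  A point of [D] belongs to the piece
    on its right, so only the points of ]x, y] can separate [x] from [y]. *)
Record piecewise_translation (f : R -> R) (D : seq R) : Prop := {
  pt_range : forall x, 0 <= x < 1 -> 0 <= f x < 1;
  pt_inj : forall x y, 0 <= x < 1 -> 0 <= y < 1 -> f x = f y -> x = y;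
  pt_transl : forall x y, 0 <= x -> x <= y -> y < 1 ->
    (forall p, p \in D -> ~~ (x < p <= y)) -> f y - f x = y - x }.

Definition interval_mixing (f : R -> R) : Prop :=
  forall a b c d, 0 <= a -> a < b -> b <= 1 -> 0 <= c -> c < d -> d <= 1 ->
  exists N, forall n, (N <= n)%N -> exists x, a < x < b /\ c < iter n f x < d.

Variables (f : R -> R) (D : seq R).
Hypothesis fD : piecewise_translation f D.
Hypothesis mixf : interval_mixing f.

Lemma iter_range n x : 0 <= x < 1 -> 0 <= iter n f x < 1.
Proof. by move=> x01; elim: n => //= n; apply: pt_range fD _. Qed.

Lemma iter_inj n x y : 0 <= x < 1 -> 0 <= y < 1 ->
  iter n f x = iter n f y -> x = y.
Proof.
move=> x01 y01; elim: n => //= n IH /(pt_inj fD) xy.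
by apply/IH/xy; apply: iter_range.
Qed.

(** A break point cuts only on its left, so an iterate is a translation on a
    right neighbourhood of every point, even of a point where it jumps. *)
Lemma iter_transl_right x n : 0 <= x < 1 ->
  exists2 y, x < y <= 1 & forall k z, (k <= n)%N -> x <= z < y ->
    iter k f z - iter k f x = z - x.
Proof.
move=> x01; elim: n => [|n [y /andP[xy y1] IH]].
  by exists 1 => [|k z]; [case/andP: x01 => _ ->; rewrite lexx|case: k].
have [e [eD xe emin]] := @next_in_seq [seq p - iter n f x + x | p <- D] y x xy.
have ey : e <= y by apply: emin; rewrite ?mem_head.
exists e => [|k z]; first by rewrite xe (le_trans ey).
rewrite leq_eqVlt => /orP[/eqP ->|]; last first.
  by rewrite ltnS => kn /andP[xz ze]; apply: IH; rewrite ?xz ?(lt_le_trans ze).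
move=> /andP[xz ze].
have xzy : x <= z < y by rewrite xz (lt_le_trans ze).
have zn := IH n z (leqnn n) xzy.
have z01 : 0 <= z < 1 by lra.
have /andP[fz0 fz1] := iter_range n z01.
have /andP[fx0 fx1] := iter_range n x01.
rewrite !iterS -zn; apply: (pt_transl fD) => //; first by lra.
move=> p pD; apply/negP => /andP[h1 h2].
have : e <= p - iter n f x + x.
  by apply: emin; [rewrite inE; apply/orP; right; apply/mapP; exists p|lra].
by lra.
Qed.

(** * Rokhlin towers over an interval *)

Section ReturnTowers.
Variables a b : R.
Hypotheses (a0 : 0 <= a) (ab : a < b) (b1 : b <= 1).

Definition no_return k x := forall j, (0 < j <= k)%N -> ~~ (a <= iter j f x < b).

Lemma base_range x : a <= x < b -> 0 <= x < 1.
Proof. by move: a0 b1 => ? ?; lra. Qed.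

Definition last_exit p w :=
  a <= w < b /\ exists2 k, iter k f w = p & no_return k w.

(** Of two such points, injectivity of [f] makes one an iterate of the other;
    as both lie in [J = [a, b)], this iterate would be an early return. *)
Lemma last_exit_inj p w w' : last_exit p w -> last_exit p w' -> w = w'.
Proof.
wlog : w w' / exists k k', [/\ (k <= k')%N, iter k f w = p, iter k' f w' = p,
                               no_return k w & no_return k' w'].
  move=> H h h'; have [_ [k kw nk]] := h; have [_ [k' kw' nk']] := h'.
  have [kk'|/ltnW kk'] := leqP k k'; first by apply: H => //; exists k, k'.
  by symmetry; apply: H => //; exists k', k.
move=> [k [k' [kk' kw kw' _ nk']]] [Jw _] [Jw' _].
have [w01 w01'] := (base_range Jw, base_range Jw').
have E : w = iter (k' - k) f w'.
  apply: (@iter_inj k) => //; first exact: iter_range.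
  by rewrite -iterD subnKC // kw kw'.
have [kE|kpos] := posnP (k' - k)%N; first by rewrite E kE.
by have := nk' (k' - k)%N; rewrite kpos leq_subr -E Jw => /(_ isT).
Qed.

(** The points of [J] at which the return map can break.  The targets [a] and [b]
    are replaced by their preimages because [a] lies in [J]: reaching [a] is
    itself a return, and only the earlier times must be free of returns.  By
    [last_exit_inj] each target contributes at most one marker. *)
Lemma cell_markers : exists2 s, size s = (size D + 2)%N &
  forall w k p, a <= w < b -> no_return k w ->
    [\/ p \in D /\ iter k f w = p, iter k.+1 f w = a | iter k.+1 f w = b] ->
    w \in s.
Proof.
pose pre x := xget 0 [set u | 0 <= u < 1 /\ f u = x]%classic.
have preE u : 0 <= u < 1 -> pre (f u) = u.
  move=> u01; apply: xget_unique => // v [v01 vu].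
  exact: (pt_inj fD).
pose g p := xget 0 (last_exit p).
have gE p w : last_exit p w -> g p = w.
  by move=> pw; apply: xget_unique => // v pv; apply: last_exit_inj pv pw.
exists [seq g p | p <- [:: pre a, pre b & D]] => [|w k p Jw nk h].
  by rewrite size_map /= addn2.
have w01 := base_range Jw; have k01 := iter_range k w01.
have kx : last_exit (iter k f w) w by split=> //; exists k.
rewrite -(gE _ _ kx); apply: map_f; rewrite !inE.
case: h => [[pD ->]|/= wa|/= wb]; first by rewrite pD !orbT.
- by rewrite -wa preE ?eqxx.
- by rewrite -wb preE ?eqxx ?orbT.
Qed.

(** A Rokhlin tower of height [h] over the cell [p, e), with its top sent into
    [a, b). *)
Definition return_tower p e h :=
  [/\ a <= p, p < e, e <= b, (0 < h)%N & forall y, p <= y < e ->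
    (forall k, (k <= h)%N -> iter k f y - iter k f p = y - p) /\
    a <= iter h f y < b].

(** As long as the orbit of [p] has not returned, the images of the cell are
    intervals that are not cut by a break point or by an endpoint of [J]: the
    point of the cell sent there would be a marker inside the cell.  Hence the cell returns as a whole; it does
    return since mixing sends some point of it into [J]. *)
Lemma cell_return_tower s p e :
  (forall w k q, a <= w < b -> no_return k w ->
    [\/ q \in D /\ iter k f w = q, iter k.+1 f w = a | iter k.+1 f w = b] ->
    w \in s) ->
  a <= p -> p < e -> e <= b -> (forall q, q \in s -> ~~ (p < q < e)) ->
  exists h, return_tower p e h.
Proof.
move=> sP ap pe eb pes.
have sN w k q : no_return k w -> p < w < e ->
    ~ [\/ q \in D /\ iter k f w = q, iter k.+1 f w = a | iter k.+1 f w = b].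
  move=> nk pw h; have ws : w \in s by apply: (sP w k q) => //; lra.
  by have := pes _ ws; rewrite pw.
have p01 : 0 <= p < 1 by move: a0 b1 => ? ?; lra.
have step k : (forall w, p <= w < e -> no_return k w) ->
    (forall w, p <= w < e -> iter k f w - iter k f p = w - p) ->
    forall w, p <= w < e -> iter k.+1 f w - iter k.+1 f p = w - p.
  move=> nk tk w pw; have w01 : 0 <= w < 1 by move: a0 b1 => ? ?; lra.
  have kp := iter_range k p01; have kw := iter_range k w01.
  rewrite !iterS -(tk w pw); apply: (pt_transl fD); have := tk w pw; try by lra.
  move=> twk q qD; apply/negP => qin.
  (* [u] is the point of the cell that the [k]-th iterate sends to [q]. *)
  pose u := q - iter k f p + p.
  have pu : p < u < e by rewrite /u; lra.
  have pu' : p <= u < e by lra.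
  apply: (sN u k q (nk u pu') pu); apply: Or31; split=> //.
  by have := tk u pu'; rewrite {2}/u; lra.
have flow k : no_return k p -> forall w, p <= w < e ->
    no_return k w /\ forall j, (j <= k.+1)%N -> iter j f w - iter j f p = w - p.
  elim: k => [|k IH] np w pw.
    split=> [j|[|[|]]//= _]; first by case: j.
    by apply: (step 0%N) => // u _ [].
  have npk : no_return k p.
    by move=> j /andP[j0 jk]; apply: np; rewrite j0 (leq_trans jk).
  have {}IH := IH npk.
  have nk1 u : p <= u < e -> no_return k.+1 u.
    move=> pu j /andP[j0]; rewrite leq_eqVlt => /orP[/eqP jk|jk]; last first.
      by have [+ _] := IH _ pu; apply; rewrite j0 -ltnS.
    rewrite {j j0}jk; apply/negP => Ju.
    have npk1 := np k.+1 (leqnn k.+1).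
    have [_ /(_ k.+1 (leqnn k.+1)) tu] := IH _ pu.
    (* If [u] returns before [p] does, then some [v] in ]p, u] lands on [a]. *)
    pose v := p + (a - iter k.+1 f p).
    have /negP npk1' := npk1.
    have lt_a : iter k.+1 f p < a.
      by rewrite ltNge; apply/negP => h; apply: npk1'; lra.
    have pv : p < v < e by rewrite /v; lra.
    have pv' : p <= v < e by lra.
    have [nv /(_ k.+1 (leqnn k.+1)) tv] := IH _ pv'.
    apply: (sN v k 0 nv pv); apply: Or32.
    by rewrite /v in tv *; lra.
  split; first exact: nk1.
  move=> j; rewrite leq_eqVlt => /orP[/eqP ->|jk].
    by apply: step => // u pu; have [_ ->] := IH _ pu.
  by have [_ ->] := IH _ pw.
have exh : exists h, (0 < h)%N && (a <= iter h f p < b).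
  have [N /(_ (maxn N 1) (leq_maxl _ _))] :=
    @mixf p e a b ltac:(lra) pe ltac:(move: b1; lra) a0 ab b1.
  set n := maxn N 1 => -[w [pw Jw]].
  have n0 : (0 < n)%N by rewrite /n leq_max orbT.
  have [//|nex] := pselect (exists h, (0 < h)%N && (a <= iter h f p < b)).
  have np : no_return n p.
    by move=> j /andP[j0 jn]; apply/negP => Jp; apply: nex; exists j; rewrite j0.
  have pw' : p <= w < e by lra.
  have [/(_ n) + _] := flow n np w pw'; rewrite n0 leqnn => /(_ isT) /negP[].
  by lra.
case: (ex_minnP exh) => -[//|h] /= Jh hmin; exists h.+1; split=> // y py.
have np : no_return h p.
  move=> j /andP[j0 jh]; apply/negP => Jp.
  by have := hmin j; rewrite j0 Jp => /(_ isT); rewrite ltnNge jh.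
have [_ ty] := flow h np y py; split=> //.
have /= tyh := ty h.+1 (leqnn _).
case: (ltP (f (iter h f y)) b) => [yb|by_]; first by lra.
(* If [y] lands beyond [b], then some [v] in ]p, y] lands on [b]. *)
pose v := p + (b - f (iter h f p)).
have pv : p < v < e by rewrite /v; lra.
have pv' : p <= v < e by lra.
have [nv /(_ h.+1 (leqnn h.+1)) /= tv] := flow h np v pv'.
case: (sN v h 0 nv pv); apply: Or33 => /=.
by rewrite /v in tv *; lra.
Qed.

(** The cells start at [a] or at a marker and end at the next marker or at [b]. *)
Lemma return_towers : exists (A : seq R) (e : R -> R) (h : R -> nat),
  [/\ (size A <= size D + 3)%N,
      forall p, p \in A -> return_tower p (e p) (h p) &
      forall y, a <= y < b -> exists2 p, p \in A & p <= y < e p].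
Proof.
have [s sz sP] := cell_markers.
have /choice[e eP] : forall p, exists e, p < b ->
    [/\ e \in b :: s, p < e & forall q, q \in b :: s -> p < q -> e <= q].
  move=> p; case: (ltP p b) => [pb|]; last by exists 0.
  by have [e ?] := @next_in_seq s b p pb; exists e.
have eb p : p < b -> e p <= b.
  by move=> pb; have [_ _ ->//] := eP p pb; rewrite mem_head.
have /choice[h hP] : forall p, exists h, a <= p < b -> return_tower p (e p) h.
  move=> p; case: (boolP (a <= p < b)) => [/andP[ap pb]|_]; last by exists 0%N.
  have [_ pe emin] := eP p pb.
  have [q qs|h ?] := @cell_return_tower s p (e p) sP ap pe (eb p pb).
    apply/negP => /andP[pq qe]; have := emin q.
    by rewrite inE qs orbT => /(_ isT pq); rewrite leNgt qe.
  by exists h.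
exists [seq p <- a :: s | a <= p < b], e, h; split.
- rewrite size_filter; apply: leq_trans (count_size _ _) _ => /=.
  by rewrite sz addn2 addn3.
- by move=> p; rewrite mem_filter => /andP[Jp _]; apply: hP.
- move=> y /andP[ay yb]; have [p [ps py pmax]] := @floor_in_seq s a y ay.
  have ap : a <= p by apply: pmax; rewrite ?mem_head.
  have pb := le_lt_trans py yb; have [es pe emin] := eP p pb.
  exists p; first by rewrite mem_filter ap pb.
  rewrite py ltNge; apply/negP => ey.
  have := pmax (e p); move: es; rewrite !inE => /orP[/eqP eb'|es].
    by move: ey; rewrite eb' leNgt yb.
  by rewrite es orbT => /(_ isT ey); rewrite leNgt pe.
Qed.

End ReturnTowers.

(** * Simultaneous recurrence *)

(** Towers over [J = [a, b)], then towers over each cell of [J].  Here [h] is the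
    height of the tower above [y], and [r] is a return time to the cell of [y], so that
    [y] and its [r]-th iterate climb this tower in parallel. *)
Lemma recurrence_times a b : 0 <= a -> a < b -> b <= 1 ->
  exists rs : seq nat, [/\ (size rs <= (size D + 3) ^ 2)%N,
    forall r, r \in rs -> (0 < r)%N /\
      exists2 y, a <= y < b & a <= iter r f y < b &
    forall y, a <= y < b -> exists2 r, r \in rs & exists h,
      [/\ (0 < h)%N, a <= iter h f y < b & a <= iter r f y < b] /\
      (forall k, (k <= h)%N ->
         iter k f (iter r f y) - iter k f y = iter r f y - y) /\
      a <= iter h f (iter r f y) < b].
Proof.
move=> a0 ab b1; have [A [e [h [szA tow cover]]]] := return_towers a0 ab b1.
have /choice[H HP] : forall p, exists H : seq nat, p \in A ->
    [/\ (size H <= size D + 3)%N,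
        forall r, r \in H -> (0 < r)%N /\
          exists2 y, p <= y < e p & p <= iter r f y < e p &
        forall y, p <= y < e p -> exists2 r, r \in H & p <= iter r f y < e p].
  move=> p; case: (boolP (p \in A)) => [pA|_]; last by exists [::].
  have [ap pe eb _ _] := tow p pA.
  have [A' [e' [h' [szA' tow' cover']]]] :=
    return_towers (le_trans a0 ap) pe (le_trans eb b1).
  exists (map h' A') => _; split; first by rewrite size_map.
    move=> r /mapP[q qA' ->]; have [pq qe' e'e h0 tq] := tow' q qA'.
    split=> //; exists q; first by rewrite pq (lt_le_trans qe').
    by have [] := tq q; rewrite ?lexx.
  move=> y /cover'[q qA' qy]; exists (h' q); first exact: map_f.
  by have [_ _ _ _ /(_ y qy)[]] := tow' q qA'.
exists (flatten (map H A)); split.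
- rewrite size_flatten /shape -map_comp expnS expn1.
  apply: leq_trans (leq_mul szA (leqnn _)).
  elim: A HP {szA tow cover} => //= p A IH HP.
  rewrite mulSn leq_add //; first by have [] := HP p (mem_head _ _).
  by apply: IH => q qA; apply: HP; rewrite inE qA orbT.
- move=> r /flatten_mapP[p pA rH]; have [_ /(_ r rH)[r0 [y py pry]] _] := HP p pA.
  have [ap pe eb _ _] := tow p pA.
  by split=> //; exists y; lra.
- move=> y Jy; have [p pA py] := cover y Jy.
  have [_ _ /(_ y py)[r rH pry]] := HP p pA.
  exists r; first by apply/flatten_mapP; exists p.
  have [ap pe eb h0 tp] := tow p pA.
  have [ty Jhy] := tp y py; have [try_ Jhry] := tp _ pry.
  exists (h p); split; split=> //; first by lra.
  by move=> k kh; have := ty k kh; have := try_ k kh; lra.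
Qed.

Lemma last_visit a b n y : a <= y < b -> exists z k,
  [/\ a <= z < b, iter k f z = iter n f y &
      forall j, (0 < j <= k)%N -> ~~ (a <= iter j f z < b)].
Proof.
move=> Jy; elim: n => [|n [z [k [Jz kz nk]]]].
  by exists y, 0%N; split=> // -[].
case: (boolP (a <= iter k.+1 f z < b)) => Jk.
  by exists (iter k.+1 f z), 0%N; split=> // [|[]//]; rewrite /= kz.
exists z, k.+1; split=> // [|j]; first by rewrite /= kz.
move=> /andP[j0]; rewrite leq_eqVlt => /orP[/eqP->//|jk].
by apply: nk; rewrite j0.
Qed.

(** Otherwise an iterate fixes a whole interval [0, y), and multiples of [n]
    steps never bring its left half to the right half, against mixing. *)
Lemma origin_not_periodic n : (0 < n)%N -> iter n f 0 <> 0.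
Proof.
move=> n0 fn0; have z01 : 0 <= (0 : R) < 1 by rewrite lexx ltr01.
have [y /andP[y0 y1] ty] := iter_transl_right n z01.
have tn z : 0 <= z < y -> iter n f z = z.
  by move=> zy; have := ty n z (leqnn n) zy; rewrite fn0; lra.
have [N /(_ (N * n)%N)] := @mixf 0 (y / 2) (y / 2) y ltac:(lra) ltac:(lra)
  ltac:(lra) ltac:(lra) ltac:(lra) ltac:(lra).
rewrite leq_pmulr // => /(_ isT)[x [xy]].
suff -> : iter (N * n) f x = x by lra.
elim: N => // N IH; rewrite mulSn iterD IH tn //.
by lra.
Qed.

(** This base is disjoint from its first [M] images, so that its return times
    exceed [M].  Where the iterates are translations, it is enough for this that
    [c] be at most each of the positive numbers [iter k f 0]. *)
Lemma small_base M : exists c, [/\ 0 < c, c <= 1 / 2,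
  forall k y, (k <= M)%N -> 0 <= y < c -> iter k f y - iter k f 0 = y &
  forall k y, (0 < k <= M)%N -> 0 <= y < c -> ~~ (0 <= iter k f y < c)].
Proof.
have z01 : 0 <= (0 : R) < 1 by rewrite lexx ltr01.
have [y /andP[y0 y1] ty] := iter_transl_right M z01.
have m0 : 0 < Num.min y (1 / 2 : R) by rewrite lt_min y0; lra.
have [c [_ c0 cmin]] :=
  next_in_seq [seq iter k f 0 | k <- iota 1 M] m0.
have : c <= Num.min y (1 / 2 : R) by apply: cmin; rewrite ?mem_head.
rewrite le_min => /andP[cy c2].
have tc k z : (k <= M)%N -> 0 <= z < c -> iter k f z - iter k f 0 = z.
  by move=> kM zc; rewrite ty //; lra.
exists c; split=> // k z /andP[k0 kM] zc; have := tc k z kM zc.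
have /andP[f0 _] := iter_range k z01.
have : c <= iter k f 0.
  apply: cmin; last by rewrite lt_def f0 andbT; apply/eqP/origin_not_periodic.
  rewrite inE; apply/orP; right; apply/mapP; exists k => //.
  by rewrite mem_iota k0 add1n ltnS.
by move=> cf tz; apply/negP; lra.
Qed.

(** Orbits of the base [0, c) need not pass through [x] itself, but they pass
    through points [x'] just to its right, whose orbit runs parallel to that of
    [x] for as long as needed. *)
Lemma simultaneous_recurrence M : exists rs : seq nat,
  [/\ (size rs <= (size D + 3) ^ 2)%N, forall r, r \in rs -> (M < r)%N &
      forall x, 0 <= x < 1 -> exists2 r, r \in rs &
        forall k, (k <= M)%N -> `|iter (k + r) f x - iter k f x| < 1 / 2].
Proof.
have [c [c0 c2 tc nc]] := small_base M.
have [rs [szrs rpos rec]] := recurrence_times (lexx 0) c0 ltac:(lra).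
exists rs; split=> // [r rrs|x x01].
  have [r0 [y Jy Jry]] := rpos r rrs.
  rewrite ltnNge; apply/negP => rM.
  by have := nc r y; rewrite r0 rM Jry => /(_ isT Jy).
pose K := (M + \sum_(r <- rs) r)%N.
have rK r k : r \in rs -> (k <= M)%N -> (k + r <= K)%N.
  by move=> rrs kM; rewrite leq_add // (big_rem r) //= leq_addr.
have [e /andP[xe e1] te] := iter_transl_right K x01.
have [N /(_ N (leqnn N))[u [uc ux]]] := @mixf 0 c x e ltac:(lra) c0 ltac:(lra)
  ltac:(lra) xe e1.
(* The point [iter N f u], called [x'] below, is at level [n] of the tower over
   the cell of [y]. *)
have [y [n [Jy ny last_y]]] := @last_visit 0 c N u ltac:(lra).
have [r rrs [h [[h0 Jhy Jry] [th Jhry]]]] := rec y Jy.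
exists r => // k kM; set x' := iter N f u in ux ny.
have xx' : x <= x' < e by lra.
have := te k x' ltac:(by rewrite /K (leq_trans kM) ?leq_addr) xx'.
have := te (k + r)%N x' (rK r k rrs kM) xx'.
suff : `|iter (k + r) f x' - iter k f x'| < 1 / 2.
  by rewrite !ltr_norml; lra.
have nh' : (n < h)%N.
  rewrite ltnNge; apply/negP => hn.
  by have := last_y h; rewrite h0 hn Jhy => /(_ isT).
rewrite -ny -!iterD addnAC (iterD (k + n)).
(* Either both points are still in the tower, or both went through its top. *)
have [knh|/ltnW hkn] := leqP (k + n) h.
  by rewrite th // ltr_norml; lra.
have mM : (k + n - h <= M)%N.
  by rewrite leq_subLR (leq_trans (leq_add kM (ltnW nh'))) // addnC.
have E z : iter (k + n) f z = iter (k + n - h) f (iter h f z).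
  by rewrite -iterD subnK.
rewrite !E ltr_norml.
have := tc _ _ mM Jhry; have := tc _ _ mM Jhy.
by lra.
Qed.

End PiecewiseTranslations.

(** * Interval exchanges as piecewise translations *)

Section IntervalExchanges.

Set Implicit Arguments.
Unset Strict Implicit.
Unset Printing Implicit Defensive.
Import Order.TTheory GRing.Theory Num.Theory.
Local Open Scope classical_set_scope.
Local Open Scope ring_scope.

Variable R : realType.

(** The order and arithmetic of the real line are more convenient than those of
    the subtype; the value outside [0, 1) is arbitrary. *)
Definition real_map (T : unit_ico R -> unit_ico R) (x : R) : R :=
  oapp (fun u : unit_ico R => val (T u)) x (insub x).

Lemma unit_icoP (u : unit_ico R) : 0 <= val u < 1.
Proof. by have := set_mem (valP u); rewrite /unit_ico /= in_itv. Qed.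

Lemma unit_ico_ex (x : R) : 0 <= x < 1 -> exists u : unit_ico R, val u = x.
Proof.
move=> x01; have xI : x \in unit_ico R by rewrite inE /unit_ico /= in_itv.
by exists (exist _ x xI).
Qed.

Lemma real_mapE T u : real_map T (val u) = val (T u).
Proof. by rewrite /real_map valK. Qed.

Lemma iter_real_map T n u : iter n (real_map T) (val u) = val (iter n T u).
Proof. by elim: n => //= n ->; rewrite real_mapE. Qed.

Lemma partial_sum_le d (l : 'I_d -> R) (P Q : pred 'I_d) :
  (forall k, 0 < l k) -> (forall k, P k -> Q k) ->
  \sum_(k | P k) l k <= \sum_(k | Q k) l k.
Proof.
move=> l0 PQ; rewrite [leLHS]big_mkcond [leRHS]big_mkcond.
apply: ler_sum => k _; case: (boolP (P k)) => [/PQ ->//|_].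
by case: ifP => // _; apply: ltW.
Qed.

Lemma partial_sumS d (l : 'I_d -> R) (g : 'I_d -> 'I_d) j : injective g ->
  \sum_(k | (g k <= g j)%N) l k = l j + \sum_(k | (g k < g j)%N) l k.
Proof.
move=> gI; rewrite (bigD1 j) //=; congr (_ + _); apply: eq_bigl => k.
by rewrite ltn_neqAle andbC (inj_eq val_inj) (inj_eq gI).
Qed.

(** Injectivity holds because the images of the intervals again follow one
    another, in the order given by [pi]. *)
Lemma iet_piecewise_translation d (l : 'I_d -> R) (pi : 'S_d) T :
  simplex R d l -> is_iet l pi T ->
  piecewise_translation (real_map T)
    [seq \sum_(k < d | (k < j)%N) l k | j : 'I_d <- enum 'I_d].
Proof.
move=> sl Tl; have [l0 l1] := sl.
have cover (u : unit_ico R) : exists j, iet_interval l j (val u).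
  exact: (simplex_cover sl (set_mem (valP u))).
have valT u j : iet_interval l j (val u) ->
    val (T u) = val u - \sum_(k < d | (k < j)%N) l k
                      + \sum_(k < d | (pi k < pi j)%N) l k := Tl u j.
split=> [x /unit_ico_ex[u <-]|x y|x y x0 xy y1 nD].
- by rewrite real_mapE; apply: unit_icoP.
- move=> /unit_ico_ex[u <-] /unit_ico_ex[v <-]; rewrite !real_mapE.
  have [[i ui] [j vj]] := (cover u, cover v).
  have img w i' : iet_interval l i' (val w) ->
      \sum_(k < d | (pi k < pi i')%N) l k <= val (T w) <
      \sum_(k < d | (pi k <= pi i')%N) l k.
    move=> wi; rewrite (valT _ _ wi); move: wi.
    rewrite /iet_interval /= in_itv /= (partial_sumS l (g := id) i') //.
    rewrite (partial_sumS l i' (@perm_inj _ pi)).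
    by lra.
  have [pij|pji|/val_inj/perm_inj ij] := ltngtP (pi i) (pi j).
  + have := img _ _ ui; have := img _ _ vj.
    have := @partial_sum_le d l (fun k => pi k <= pi i)%N
      (fun k => pi k < pi j)%N l0 (fun k h => leq_ltn_trans h pij).
    by move=> h1 h2 h3 h4; exfalso; lra.
  + have := img _ _ ui; have := img _ _ vj.
    have := @partial_sum_le d l (fun k => pi k <= pi j)%N
      (fun k => pi k < pi i)%N l0 (fun k h => leq_ltn_trans h pji).
    by move=> h1 h2 h3 h4; exfalso; lra.
  + by rewrite (valT _ _ ui) (valT _ _ vj) ij; lra.
have x01 : 0 <= x < 1 by lra.
have y01 : 0 <= y < 1 by lra.
case/unit_ico_ex: x01 => u ux; case/unit_ico_ex: y01 => v vy; subst x y.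
have [[i ui] [j vj]] := (cover u, cover v).
rewrite !real_mapE (valT _ _ ui) (valT _ _ vj).
have [ij|ji|/val_inj ->] := ltngtP i j; last by lra.
- have := nD (\sum_(k < d | (k < j)%N) l k).
  rewrite (map_f (fun j : 'I_d => \sum_(k < d | (k < j)%N) l k)) ?mem_enum //.
  move=> /(_ isT); move: ui vj; rewrite /iet_interval /= !in_itv /=.
  have := @partial_sum_le d l (fun k => k <= i)%N (fun k => k < j)%N l0
      (fun k h => leq_ltn_trans h ij).
  by move=> h1 h2 h3 /negP[]; lra.
- move: ui vj; rewrite /iet_interval /= !in_itv /=.
  have := @partial_sum_le d l (fun k => k <= j)%N (fun k => k < i)%N l0
      (fun k h => leq_ltn_trans h ji).
  move=> h1 /andP[h2 _] /andP[_ h3].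
  by have := lt_le_trans h3 (le_trans h1 (le_trans h2 xy)); rewrite ltxx.
Qed.

Lemma mixing_all_orders_intervals T p (lo hi : nat -> R) :
  mixing_all_orders T -> (1 <= p)%N ->
  (forall i, (i <= p)%N -> [/\ 0 <= lo i, lo i < hi i & hi i <= 1]) ->
  exists N, forall n : nat -> nat, (N <= n 1)%N ->
    (forall i, (1 <= i < p)%N -> (n i + N <= n i.+1)%N) ->
    exists x, lo 0%N < x < hi 0%N /\
      forall i, (1 <= i <= p)%N -> lo i < iter (n i) (real_map T) x < hi i.
Proof.
move=> mixT p1 lohi.
pose U i : set (unit_ico R) := (fun u => val u) @^-1` `]lo i, hi i[.
have Uprop i : (i <= p)%N -> open (U i) /\ U i !=set0.
  move=> ip; have [lo0 lt hi1] := lohi i ip; split.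
    apply: open_comp; last exact: interval_open.
    by move=> u _; apply: initial_continuous.
  have [u um] := @unit_ico_ex ((lo i + hi i) / 2) ltac:(lra).
  by exists u; rewrite /U /= um in_itv /=; lra.
have [N HN] := mixT p U p1 Uprop; exists N => n n1 gaps.
have [u [U0 Uu]] := HN n n1 gaps.
exists (val u); split; first by move: U0; rewrite /U /= in_itv.
by move=> i ip; rewrite iter_real_map; have := Uu i ip; rewrite /U /= in_itv.
Qed.

End IntervalExchanges.

(** * Failure of mixing of all orders *)

Import Order.TTheory GRing.Theory Num.Theory.

Theorem theorem2 (R : realType) (d : nat) (l : 'I_d -> R) (pi : 'S_d)
    (T : unit_ico R -> unit_ico R) :
  (1 <= d)%N -> simplex R d l -> is_iet l pi T -> ~ mixing_all_orders T.
Proof.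
move=> _ sl Tl mixT; pose f := real_map T.
have fD := iet_piecewise_translation sl Tl.
set D := (X in piecewise_translation _ X) in fD.
have mixf : interval_mixing f.
  move=> a b c e a0 ab b1 c0 ce e1.
  have [|N HN] := @mixing_all_orders_intervals R T 1
    (fun i => if i is 0 then a else c) (fun i => if i is 0 then b else e)
    mixT isT; first by case.
  exists N => n Nn; have [|x [x0 x1]] := HN (fun=> n) Nn; first by case=> [|[]].
  by exists x; split=> //; apply: (x1 1%N).
set s := ((size D + 3) ^ 2)%N.
have s0 : (0 < s)%N by rewrite expn_gt0 addn3.
have [|N HN] := @mixing_all_orders_intervals R T (s + s)
  (fun i => if (i <= s)%N then 0%R else (3 / 4)%R)
  (fun i => if (i <= s)%N then (1 / 4)%R else 1%R) mixT (ltn_addl _ s0).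
  by move=> i _; case: ifP => _; split; lra.
pose M := (s * N)%N.
have [rs [szrs Mrs rec]] := simultaneous_recurrence fD mixf M.
(* Padding with [M.+1] makes the number of times exactly [s], the number for
   which [N] was chosen. *)
pose t := sort leq (rs ++ nseq (s - size rs) M.+1).
have szt : size t = s by rewrite size_sort size_cat size_nseq subnKC.
have tM j : (j < s)%N -> (M < nth 0 t j)%N.
  rewrite -szt => /(mem_nth 0); rewrite mem_sort mem_cat => /orP[/Mrs//|].
  by rewrite mem_nseq => /andP[_ /eqP ->].
have tle j : (j.+1 < s)%N -> (nth 0 t j <= nth 0 t j.+1)%N.
  move=> js; apply: (sorted_leq_nth leq_trans leqnn) => //.
  - exact: (sort_sorted leq_total).
  - by rewrite inE szt ltnW.
  - by rewrite inE szt.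
(* For [i > s], the index in [t], counted from 0, is one less than the multiple
   of [N]. *)
pose n i :=
  if (i <= s)%N then (i * N)%N else (nth 0 t (i - s).-1 + (i - s) * N)%N.
have [||x [x0 xn]] := HN n.
- by rewrite /n s0 mul1n.
- move=> i /andP[i1 i2]; rewrite /n.
  have [is_|si|->] := ltngtP i s.
  + by rewrite mulSn addnC.
  + rewrite subSn ?(ltnW si) // mulSn /=.
    have -> : (i - s = (i - s).-1.+1)%N by rewrite prednK // subn_gt0.
    have := tle (i - s).-1; rewrite prednK ?subn_gt0 // => /(_ _).
    rewrite ltn_subLR ?(ltnW si) // => /(_ i2) => h.
    by rewrite addnA addnC addnA leq_add2r addnC leq_add2r.
  + by rewrite subSnn mul1n leq_add2r; apply/ltnW/tM.
have x01 : (0 <= x < 1)%R by move: x0; rewrite leq0n; lra.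
have [r rrs close] := rec x x01.
have rt : r \in t by rewrite mem_sort mem_cat rrs.
pose i := (index r t).+1.
have is_ : (i <= s)%N by rewrite -szt index_mem.
have := close (i * N)%N (leq_mul is_ (leqnn N)).
have := xn i; rewrite /n is_ /= (leq_trans is_) ?leq_addr // => /(_ isT).
have := xn (s + i)%N.
have si : (s + i <= s)%N = false by rewrite -[leqRHS]addn0 leq_add2l.
have -> : n (s + i)%N = (i * N + r)%N.
  by rewrite /n si addKn /= nth_index // addnC.
rewrite si.
rewrite ltn_addr // leq_add2l is_ => /(_ isT).
by rewrite -/f ltr_norml; lra.
Qed.
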